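(* For objects $(A,\rho),(A',\rho')$ of $\mathbf{Preord}$, let $R_{A,A'}$ be the relation on $\mathrm{Hom}(A,A')$ defined, for all $f,g\colon(A,\rho)\to(A',\rho')$, by $f\,R_{A,A'}\,g$ if there exists a clopen subset $B$ of $A$ such that $f|_B$ and $g|_B$ are trivial morphisms and $f|_{A\setminus B}=g|_{A\setminus B}$. Then the assignment $(A,A')\mapsto R_{A,A'}$ is a congruence on the category $\mathbf{Preord}$.
   Context: $\mathbf{Preord}$ is the category whose objects are pairs $(A,\rho)$ with $A$ a non-empty set and $\rho$ a preorder (reflexive, transitive relation) on $A$, and whose morphisms are the preorder-preserving maps. A trivial object is an object $(B,=)$ with $=$ the equality relation; a morphism is trivial if it factors through a trivial object. A subset $B$ of a preordered set $(A,\rho)$ is clopen if for every $a\in A\setminus B$ and $b\in B$ neither $a\rho b$ nor $b\rho a$ holds. Subsets carry the induced preorder; $B$ or $A\setminus B$ may be empty, and the condition on the restriction to the empty set is then vacuous. A congruence on a category (in the sense of Mac Lane) assigns to each pair of objects $A,A'$ an equivalence relation $R_{A,A'}$ on $\mathrm{Hom}(A,A')$ such that if $f\,R_{A,A'}\,g$ then $\ell fh\,R_{B,C}\,\ell gh$ for all morphisms $h\colon B\to A$ and $\ell\colon A'\to C$. *)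

(* Defs.v *)
From Stdlib Require Import RelationClasses Ensembles.

Set Implicit Arguments.
Unset Strict Implicit.
Unset Printing Implicit Defensive.

Record category := Category {
  obj :> Type;
  hom : obj -> obj -> Type;
  idc : forall A, hom A A;
  comp : forall A B C, hom B C -> hom A B -> hom A C;
  comp_idl : forall A B (f : hom A B), comp (idc B) f = f;
  comp_idr : forall A B (f : hom A B), comp f (idc A) = f;
  comp_assoc : forall A B C D (h : hom C D) (g : hom B C) (f : hom A B),
    comp h (comp g f) = comp (comp h g) f
}.

Declare Scope cat_scope.
Notation "g \o f" := (comp g f) (at level 50, left associativity) : cat_scope.
Local Open Scope cat_scope.

Record congruence (C : category)
    (R : forall A A' : C, hom A A' -> hom A A' -> Prop) : Prop := Congruence {
  congruence_equiv : forall A A' : C, Equivalence (@R A A');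
  congruence_comp : forall (A A' B B' : C) (f g : hom A A')
      (h : hom B A) (l : hom A' B'),
    R A A' f g -> R B B' (l \o f \o h) (l \o g \o h)
}.

Record preordered := Preordered {
  carrier :> Type;
  nonempty : inhabited carrier;
  le : carrier -> carrier -> Prop;
  le_preorder : PreOrder le
}.

Record monotone_map (A A' : preordered) := MonotoneMap {
  mfun :> A -> A';
  mfun_le : forall x y : A, le x y -> le (mfun x) (mfun y)
}.

Definition monotone_id (A : preordered) : monotone_map A A :=
  MonotoneMap (fun (x y : A) (xy : le x y) => xy).

Definition monotone_comp (A B C : preordered)
    (g : monotone_map B C) (f : monotone_map A B) : monotone_map A C :=
  @MonotoneMap A C (fun x => g (f x))
    (fun x y xy => mfun_le g (mfun_le f xy)).

Lemma monotone_idl (A B : preordered) (f : monotone_map A B) :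
  monotone_comp (monotone_id B) f = f.
Proof. destruct f; reflexivity. Qed.

Lemma monotone_idr (A B : preordered) (f : monotone_map A B) :
  monotone_comp f (monotone_id A) = f.
Proof. destruct f; reflexivity. Qed.

Lemma monotone_compA (A B C D : preordered) (h : monotone_map C D)
    (g : monotone_map B C) (f : monotone_map A B) :
  monotone_comp h (monotone_comp g f) = monotone_comp (monotone_comp h g) f.
Proof. reflexivity. Qed.

Definition Preord : category :=
  Category monotone_idl monotone_idr monotone_compA.

Definition trivial_object (T : Preord) : Prop :=
  forall x y : carrier T, le x y <-> x = y.

Definition trivial_morphism (A A' : Preord) (f : hom A A') : Prop :=
  exists (T : Preord) (p : hom A T) (q : hom T A'),
    trivial_object T /\ f = q \o p.

Definition clopen (A : preordered) (B : Ensemble A) : Prop :=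
  forall a b : A, In A (Complement A B) a -> In A B b -> ~ le a b /\ ~ le b a.

Section Restriction.
Variables (A : preordered) (B : Ensemble A).

Definition sub_le (x y : {a : A | In A B a}) : Prop :=
  le (proj1_sig x) (proj1_sig y).

Lemma sub_le_preorder : PreOrder sub_le.
Proof.
destruct (le_preorder A) as [r t]; split.
- intros x; exact (r _).
- intros x y z; exact (t _ _ _).
Qed.

(* Objects of Preord are non-empty, so a subset is an object only in the
   presence of a proof that it is inhabited. *)
Variable ne : inhabited {a : A | In A B a}.

Definition subobject : Preord := Preordered ne sub_le_preorder.

Definition inclusion : @hom Preord subobject A :=
  @MonotoneMap subobject A (@proj1_sig A (In A B)) (fun _ _ xy => xy).

Definition restrict (A' : Preord) (f : @hom Preord A A') :
  @hom Preord subobject A' := f \o inclusion.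

End Restriction.

(* Quantifying over [ne] makes the conditions on a restriction vacuous when
   the subset is empty. *)
Definition trivial_on (A A' : Preord) (B : Ensemble (carrier A))
    (f : hom A A') : Prop :=
  forall ne, trivial_morphism (@restrict A B ne A' f).

Definition equal_on (A A' : Preord) (B : Ensemble (carrier A))
    (f g : hom A A') : Prop :=
  forall ne, @restrict A B ne A' f = @restrict A B ne A' g.

Definition clopen_related (A A' : Preord) (f g : hom A A') : Prop :=
  exists B : Ensemble (carrier A),
    clopen B /\ trivial_on B f /\ trivial_on B g /\
    equal_on (Complement (carrier A) B) f g.

(* Main.v *)
Require Import Defs.
From Stdlib Require Import RelationClasses Ensembles.
From Stdlib Require Import Classical FunctionalExtensionality ProofIrrelevance.

(** All conditions in the definition of the relation can be read on elements.
    A monotone map is trivial exactly when it identifies comparable elements: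
    a map identifying them factors through its codomain made discrete
    ([trivial_morphismP]).  A subset is clopen exactly when membership is
    invariant under comparability ([clopenP]), so any comparable pair lies
    entirely in the subset or entirely in its complement.  Hence [f] and [g]
    are related iff, for some comparability-invariant [B], both identify
    comparable elements of [B] and they agree outside [B]
    ([clopen_relatedP]).

    Reflexivity uses the empty set, and symmetry is visible.  For
    transitivity, if [f], [g] are related through [B] and [g], [h] through
    [C], the union of [B] and [C] works: a comparable pair of the union lies
    in [B], where [f] identifies it, or in [C] and outside [B], where [f]
    agrees with [g], which identifies it; [h] is treated in the same way with
    [B] and [C] exchanged.  For composition with [h] before and [l] after,
    the preimage of [B] under [h] works, because [h] preserves
    comparability. *)

Set Implicit Arguments.
Unset Strict Implicit.
Unset Printing Implicit Defensive.

Local Open Scope cat_scope.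

(** * Elementwise descriptions *)

Lemma monotone_map_ext (A A' : preordered) (f g : monotone_map A A') :
  (forall x, f x = g x) -> f = g.
Proof.
destruct f as [f f_le], g as [g g_le]; simpl; intros fg.
apply functional_extensionality in fg; subst g.
now rewrite (proof_irrelevance _ f_le g_le).
Qed.

Definition discrete (A : preordered) : Preord :=
  @Preordered A (nonempty A) eq (@Equivalence_PreOrder A eq (@eq_equivalence A)).

Lemma discrete_trivial (A : preordered) : trivial_object (discrete A).
Proof. intros x y; reflexivity. Qed.

Definition identifies_comparable (A A' : preordered) (B : Ensemble A)
    (f : A -> A') : Prop :=
  forall x y, In A B x -> In A B y -> le x y -> f x = f y.

(** The factorization of the converse runs through the discrete object on the
    codomain: the first factor is the map itself, monotone for equality by
    hypothesis, and the second is the identity, monotone by reflexivity. *)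
Lemma trivial_morphismP (A A' : Preord) (f : @hom Preord A A') :
  trivial_morphism f <-> forall x y : carrier A, le x y -> f x = f y.
Proof.
split.
- intros (T & p & q & T_trivial & ->) x y xy; simpl.
  now rewrite (proj1 (T_trivial _ _) (mfun_le p xy)).
- intros f_eq.
  assert (eq_le : forall x y : carrier A', x = y -> le x y).
  { intros x y ->; destruct (le_preorder A') as [r _]; apply r. }
  exists (discrete A'), (@MonotoneMap A (discrete A') f f_eq),
    (@MonotoneMap (discrete A') A' (fun x => x) eq_le).
  split; [apply discrete_trivial | now apply monotone_map_ext].
Qed.

Lemma trivial_onP (A A' : Preord) (B : Ensemble (carrier A))
    (f : @hom Preord A A') :
  trivial_on B f <-> identifies_comparable B f.
Proof.
split.
- intros f_trivial x y Bx By xy.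
  pose (x' := exist (In (carrier A) B) x Bx).
  pose (y' := exist (In (carrier A) B) y By).
  apply (proj1 (trivial_morphismP _) (f_trivial (inhabits x')) x' y' xy).
- intros f_eq ne; apply trivial_morphismP.
  intros [x Bx] [y By] xy; exact (f_eq x y Bx By xy).
Qed.

Lemma equal_onP (A A' : Preord) (B : Ensemble (carrier A))
    (f g : @hom Preord A A') :
  equal_on B f g <-> forall x, In _ B x -> f x = g x.
Proof.
split.
- intros fg x Bx.
  pose (x' := exist (In (carrier A) B) x Bx).
  pose (ne := inhabits x').
  exact (f_equal (fun k : monotone_map (subobject ne) A' => k x') (fg ne)).
- intros fg ne; apply monotone_map_ext; intros [x Bx]; exact (fg x Bx).
Qed.

Lemma clopenP (A : preordered) (B : Ensemble A) :
  clopen B <-> forall x y : A, le x y -> (In A B x <-> In A B y).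
Proof.
split.
- intros B_clopen x y xy; split; intros Bz; apply NNPP; intros nB;
    now destruct (B_clopen _ _ nB Bz).
- intros B_inv a b nBa Bb; split; intros ab; apply nBa;
    now apply (B_inv _ _ ab).
Qed.

Lemma clopen_relatedP (A A' : Preord) (f g : @hom Preord A A') :
  clopen_related f g <->
  exists B : Ensemble (carrier A),
    (forall x y, le x y -> (In _ B x <-> In _ B y)) /\
    identifies_comparable B f /\ identifies_comparable B g /\
    (forall x, ~ In _ B x -> f x = g x).
Proof.
split; intros (B & B_clopen & fB & gB & fg); exists B.
- split; [now apply clopenP|].
  split; [now apply trivial_onP|].
  split; [now apply trivial_onP|].
  exact (proj1 (equal_onP _ _ _) fg).
- split; [now apply clopenP|].
  split; [now apply trivial_onP|].
  split; [now apply trivial_onP|].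
  exact (proj2 (equal_onP _ _ _) fg).
Qed.

(** * The congruence axioms *)

(** The invariance of [B] excludes mixed pairs: a comparable pair lies in [B],
    or lies in [C] and outside [B], where [f] may be replaced by [g].
    Transitivity needs this at both ends of a chain of related maps, with [B]
    and [C] exchanged at the second end. *)
Lemma identifies_comparable_union (A A' : preordered) (B C : Ensemble A)
    (f g : A -> A') :
  (forall x y, le x y -> (In A B x <-> In A B y)) ->
  identifies_comparable B f -> identifies_comparable C g ->
  (forall x, ~ In A B x -> f x = g x) ->
  forall x y, In A B x \/ In A C x -> In A B y \/ In A C y -> le x y ->
  f x = f y.
Proof.
intros B_inv fB gC fg x y BCx BCy xy.
destruct (classic (In A B x)) as [Bx | nBx].
- apply fB; trivial; now apply (B_inv _ _ xy).
- assert (nBy : ~ In A B y) by (intros By; apply nBx, (B_inv _ _ xy), By).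
  rewrite (fg x nBx), (fg y nBy); apply gC; tauto.
Qed.

Lemma clopen_related_refl (A A' : Preord) (f : @hom Preord A A') :
  clopen_related f f.
Proof.
apply clopen_relatedP; exists (Empty_set _).
split; [intros x y _; split; intros []|].
split; [intros x y []|].
split; [intros x y []|].
reflexivity.
Qed.

Lemma clopen_related_sym (A A' : Preord) (f g : @hom Preord A A') :
  clopen_related f g -> clopen_related g f.
Proof.
rewrite !clopen_relatedP; intros (B & B_inv & fB & gB & fg); exists B.
split; [exact B_inv|].
split; [exact gB|].
split; [exact fB|].
intros x nBx; symmetry; exact (fg x nBx).
Qed.

Lemma clopen_related_trans (A A' : Preord) (f g h : @hom Preord A A') :
  clopen_related f g -> clopen_related g h -> clopen_related f h.
Proof.
rewrite !clopen_relatedP.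
intros (B & B_inv & fB & gB & fg) (C & C_inv & gC & hC & gh).
exists (fun x => In _ B x \/ In _ C x).
split; [|split; [|split]].
- intros x y xy; specialize (B_inv _ _ xy); specialize (C_inv _ _ xy).
  unfold In in *; tauto.
- exact (identifies_comparable_union B_inv fB gC fg).
- intros x y BCx BCy.
  apply (identifies_comparable_union C_inv hC gB); [|now apply or_comm..].
  intros z nCz; symmetry; auto.
- intros x nBCx; unfold In in *; rewrite (fg x), (gh x); tauto.
Qed.

Lemma clopen_related_comp (A A' B B' : Preord) (f g : @hom Preord A A')
    (h : @hom Preord B A) (l : @hom Preord A' B') :
  clopen_related f g -> clopen_related (l \o f \o h) (l \o g \o h).
Proof.
rewrite !clopen_relatedP; intros (D & D_inv & fD & gD & fg).
exists (fun x => In _ D (h x)); simpl.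
split; [|split; [|split]].
- intros x y xy; exact (D_inv _ _ (mfun_le h xy)).
- intros x y Dx Dy xy; exact (f_equal l (fD _ _ Dx Dy (mfun_le h xy))).
- intros x y Dx Dy xy; exact (f_equal l (gD _ _ Dx Dy (mfun_le h xy))).
- intros x nDx; exact (f_equal l (fg _ nDx)).
Qed.

Theorem lemma2p8 : @congruence Preord clopen_related.
Proof.
split.
- intros A A'; split.
  + exact (@clopen_related_refl A A').
  + exact (@clopen_related_sym A A').
  + exact (@clopen_related_trans A A').
- exact clopen_related_comp.
Qed.
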